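(* Every poset learning algorithm needs an expected number of at least $n^2/4-o(n^2)$ pairwise comparisons. Precisely: there is a function $g:\{1,2,3,\dots\}\to\mathbb{R}$ with $g(n)/n^2\to 0$ as $n\to\infty$ such that for every poset learning algorithm $\phi$ and every $n\ge 1$, $$e_\phi(n)\ \ge\ \frac{n^2}{4}-g(n).$$
   Context: For an integer $n\ge 1$, identify $n$ with the set $\{0,1,\dots,n-1\}$, and let $\mathcal P(n)$ be the set of all strict partial orders (irreflexive, transitive relations) $P\subseteq n\times n$ on this (labelled) set. For $P\in\mathcal P(n)$ and distinct $a,b\in n$, the pairwise comparison $\{a,b\}$ in $P$ reveals which one of the following holds: $a\,P\,b$, or $b\,P\,a$, or neither. A poset learning algorithm $\phi$ is a deterministic procedure which, given $n\ge 1$ and an unknown $P\in\mathcal P(n)$, obtains information about $P$ only by performing pairwise comparisons in $P$ one after another. The next pair to be compared may depend on $n$ and on the results of the previous comparisons. The procedure continues until $P$ is known, i.e. until $P$ is the only element of $\mathcal P(n)$ consistent with all the results obtained (so for each fixed $n$, $\phi$ is a ternary decision tree that identifies every $P\in\mathcal P(n)$). Let $c_\phi(P)$ be the number of pairwise comparisons that $\phi$ performs until it knows $P$. The expected number of comparisons is $$e_\phi(n):=\frac{1}{|\mathcal P(n)|}\sum_{P\in\mathcal P(n)}c_\phi(P).$$ *)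

(* Defs.v *)
From HB Require Import structures.
From mathcomp Require Import all_boot all_order all_algebra.
From mathcomp Require Import all_classical all_reals all_analysis.

Set Implicit Arguments.
Unset Strict Implicit.
Unset Printing Implicit Defensive.

Import Order.TTheory GRing.Theory Num.Theory.
Import numFieldNormedType.Exports.

Local Open Scope ring_scope.

Definition strict_order n (P : {set 'I_n * 'I_n}) : bool :=
  [forall a, (a, a) \notin P] &&
  [forall a, forall b, forall c,
     ((a, b) \in P) && ((b, c) \in P) ==> ((a, c) \in P)].

Definition posets n : {set {set 'I_n * 'I_n}} := [set P | strict_order P].

Variant answer := Below | Above | Incomparable.

Definition answer_code (r : answer) : option bool :=
  match r with
  | Below => Some true | Above => Some false | Incomparable => None
  end.

Definition answer_decode (o : option bool) : answer :=
  match o with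
  | Some true => Below | Some false => Above | None => Incomparable
  end.

Lemma answer_codeK : cancel answer_code answer_decode.
Proof. by case. Qed.

HB.instance Definition _ := Finite.copy answer (can_type answer_codeK).

Definition comparison_result n (P : {set 'I_n * 'I_n}) (a b : 'I_n) : answer :=
  if (a, b) \in P then Below else if (b, a) \in P then Above else Incomparable.

Inductive decision_tree (n : nat) : Type :=
| Stop
| Compare (a b : 'I_n) (neq_ab : a != b) (next : answer -> decision_tree n).

Definition transcript n := seq ('I_n * 'I_n * answer).

Fixpoint run n (t : decision_tree n) (P : {set 'I_n * 'I_n}) : transcript n :=
  match t with
  | Stop => [::]
  | Compare a b _ next =>
      let r := comparison_result P a b in (a, b, r) :: run (next r) P
  end.

Definition consistent n (Q : {set 'I_n * 'I_n}) (s : transcript n) : bool :=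
  all (fun q => comparison_result Q q.1.1 q.1.2 == q.2) s.

Definition known n (P : {set 'I_n * 'I_n}) (s : transcript n) : bool :=
  [set Q in posets n | consistent Q s] == [set P].

Definition identifies n (t : decision_tree n) : Prop :=
  forall P, P \in posets n -> known P (run t P).

Record learning_algorithm := LearningAlgorithm {
  tree : forall n, decision_tree n;
  tree_identifies : forall n, (0 < n)%N -> identifies (tree n)
}.

(* The least k such that P is known after the first k comparisons; a tree
   that goes on after P is known is not charged for the extra comparisons. *)
Definition comparisons (phi : learning_algorithm) n
    (P : {set 'I_n * 'I_n}) : nat :=
  let s := run (tree phi n) P in
  find (fun k => known P (take k s)) (iota 0 (size s).+1).

Definition expected_comparisons (R : realType) (phi : learning_algorithm)
    (n : nat) : R :=
  (#|posets n|%:R)^-1 * \sum_(P in posets n) (comparisons phi P)%:R.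

(* Main.v *)
Require Import Defs.
From HB Require Import structures.
From mathcomp Require Import all_boot all_order all_algebra.
From mathcomp Require Import zify ring lra.
From mathcomp Require Import all_classical all_reals all_analysis.

(** For a poset [P] on [n] points, the map [h] sending a point to its number of
    predecessors is strictly increasing.  Once [h] is known, each comparison has
    only two possible outcomes, "comparable" or "incomparable", so at most
    [(n + 1) ^ n * 2 ^ k] posets are identified within [k] comparisons.  There are at
    least [2 ^ (n^2/4 - 1)] posets (those of height two with a fixed bipartition
    into minimal and maximal points), and [(n + 1) ^ n = 2 ^ o(n^2)]; hence all but a
    fraction [1/n] of the posets require [n^2/4 - o(n^2)] comparisons. *)

Set Implicit Arguments.
Unset Strict Implicit.
Unset Printing Implicit Defensive.

Import Order.TTheory GRing.Theory Num.Theory.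
Import numFieldNormedType.Exports.

Local Open Scope nat_scope.

(** * Heights and binary transcripts *)

Lemma strict_orderP n (P : {set 'I_n * 'I_n}) :
  reflect ((forall a, (a, a) \notin P) /\
           (forall a b c, (a, b) \in P -> (b, c) \in P -> (a, c) \in P))
          (strict_order P).
Proof.
apply: (iffP andP) => -[irr tr]; split.
- exact/forallP.
- move=> a b c ab bc.
  by move/forallP/(_ a)/forallP/(_ b)/forallP/(_ c): tr; rewrite ab bc.
- exact/forallP.
- apply/forallP => a; apply/forallP => b; apply/forallP => c.
  by apply/implyP => /andP[]; exact: tr.
Qed.

Definition down_set n (P : {set 'I_n * 'I_n}) (a : 'I_n) : {set 'I_n} :=
  [set b | (b, a) \in P].

Lemma down_set_proper n (P : {set 'I_n * 'I_n}) a b :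
  P \in posets n -> (a, b) \in P -> down_set P a \proper down_set P b.
Proof.
rewrite inE => /strict_orderP[irr tr] ab; apply/properP; split.
  by apply/fintype.subsetP => c; rewrite !inE => ca; exact: tr ca ab.
by exists a; rewrite !inE ?irr.
Qed.

(* The codomain is ['I_n.+1] rather than ['I_n] so that [inord] never truncates,
   even when [P] is not irreflexive. *)
Definition height n (P : {set 'I_n * 'I_n}) : {ffun 'I_n -> 'I_n.+1} :=
  [ffun a => inord #|down_set P a|].

Lemma height_lt n (P : {set 'I_n * 'I_n}) a b :
  P \in posets n -> (a, b) \in P -> height P a < height P b.
Proof.
move=> PP ab; rewrite !ffunE !inordK ?ltnS.
- exact/proper_card/down_set_proper.
- by rewrite -[X in _ <= X]card_ord max_card.
- by rewrite -[X in _ <= X]card_ord max_card.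
Qed.

(** A comparable pair must be ordered as its heights are, so [P] and [Q] cannot order it in opposite
    ways. *)
Lemma comparison_result_height n (P Q : {set 'I_n * 'I_n}) a b :
    P \in posets n -> Q \in posets n -> height P = height Q ->
    (comparison_result P a b == Incomparable) =
      (comparison_result Q a b == Incomparable) ->
  comparison_result P a b = comparison_result Q a b.
Proof.
move=> PP QP hPQ; have hP c d := height_lt (a := c) (b := d) PP.
have hQ c d := height_lt (a := c) (b := d) QP.
rewrite /comparison_result.
have [/hP|_] := boolP ((a, b) \in P); have [/hQ|_] := boolP ((a, b) \in Q) => //.
  by have [/hQ|] := boolP ((b, a) \in Q); rewrite -?hPQ //; lia.
  by have [/hP|] := boolP ((b, a) \in P); rewrite ?hPQ //; lia.
by case: ifP; case: ifP.
Qed.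

Definition incomparability_bits n (t : decision_tree n) P : seq bool :=
  [seq q.2 == Incomparable | q <- run t P].

(** Equal answers lead into the same subtree, so the next pair compared is again the same for [P]
    and [Q]. *)
Lemma take_run_eq n (t : decision_tree n) (P Q : {set 'I_n * 'I_n}) k :
    P \in posets n -> Q \in posets n -> height P = height Q ->
    (forall i, i < k -> nth false (incomparability_bits t P) i =
                        nth false (incomparability_bits t Q) i) ->
  take k (run t P) = take k (run t Q).
Proof.
move=> PP QP hPQ; elim: k t => [|k IHk] t; first by rewrite !take0.
case: t => [//|a b neq_ab next] bits /=.
have e := comparison_result_height PP QP hPQ (bits 0 (ltn0Sn k)).
by rewrite e IHk // => i ltik; have := bits i.+1 ltik; rewrite /= e.
Qed.

Lemma consistent_run n (t : decision_tree n) P : consistent P (run t P).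
Proof. by elim: t => [//|a b neq_ab next IH] /=; rewrite eqxx IH. Qed.

Lemma consistent_take n (s : transcript n) P k :
  consistent P s -> consistent P (take k s).
Proof. by rewrite -{1}(cat_take_drop k s) /consistent all_cat => /andP[]. Qed.

(** * Counting the posets identified early *)

Section Algorithm.

Variables (phi : learning_algorithm) (n : nat).
Hypothesis n_gt0 : 0 < n.

Lemma known_comparisons P : P \in posets n ->
  known P (take (comparisons phi P) (run (tree phi n) P)).
Proof.
move=> PP; rewrite /comparisons; set s := run _ _.
set p := fun k => _.
(* [find] would return the length of the list on failure; the full run identifies [P], so this
   default does not occur. *)
have hp : has p (iota 0 (size s).+1).
  apply/hasP; exists (size s); first by rewrite mem_iota /=; lia.
  by rewrite /p take_size; exact: tree_identifies.
have := nth_find 0 hp; rewrite nth_iota ?add0n //.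
by move: hp; rewrite has_find size_iota.
Qed.

Definition early k : {set {set 'I_n * 'I_n}} :=
  [set P in posets n | comparisons phi P <= k].

Definition early_code k (P : {set 'I_n * 'I_n}) :
    {ffun 'I_n -> 'I_n.+1} * {ffun 'I_k -> bool} :=
  (height P,
   [ffun i : 'I_k => nth false (incomparability_bits (tree phi n) P) i]).

(** Equal codes make [Q] consistent with the very answers that single out [P]. *)
Lemma early_code_inj k : {in early k &, injective (early_code k)}.
Proof.
move=> P Q; rewrite !inE => /andP[PP cP] /andP[QP _] [hPQ bits].
have PP' : P \in posets n by rewrite inE.
have QP' : Q \in posets n by rewrite inE.
have run_eq : take (comparisons phi P) (run (tree phi n) P) =
              take (comparisons phi P) (run (tree phi n) Q).
  apply: take_run_eq => // i lti.
  by move/ffunP/(_ (Ordinal (leq_trans lti cP))): bits; rewrite !ffunE.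
have := known_comparisons PP'; rewrite run_eq => /eqP/finset.setP/(_ Q).
rewrite !inE QP consistent_take ?consistent_run //=.
by move/esym/eqP.
Qed.

Lemma card_early k : #|early k| <= n.+1 ^ n * 2 ^ k.
Proof.
rewrite -(card_in_imset (@early_code_inj k)) (leq_trans (max_card _)) //.
by rewrite card_prod !card_ffun !card_ord card_bool.
Qed.

Lemma sum_comparisons_ge k :
  #|posets n| * k <= \sum_(P in posets n) comparisons phi P + #|early k| * k.
Proof.
rewrite -!sum_nat_const (big_setID (early k)).
rewrite [X in _ <= X + _](big_setID (early k)) /=.
have -> : posets n :&: early k = early k.
  by apply/finset.setIidPr/fintype.subsetP => P; rewrite !inE => /andP[].
rewrite addnC leq_add2r (leq_trans _ (leq_addl _ _)) // leq_sum // => P.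
by rewrite !inE => /andP[+ PP]; rewrite PP /= -ltnNge => /ltnW.
Qed.

End Algorithm.

(** * Many posets of height at most two *)

Lemma posets_bipartite n (A : {set 'I_n}) (P : {set 'I_n * 'I_n}) :
  P \subset finset.setX A (~: A) -> P \in posets n.
Proof.
move=> /fintype.subsetP sub; rewrite inE; apply/strict_orderP; split.
  by move=> a; apply/negP => /sub; rewrite !inE /= andbN.
(* Transitivity is vacuous: the middle point would lie both outside [A] and in [A]. *)
by move=> a b c /sub + /sub; rewrite !inE /= => /andP[_ /negPf ->].
Qed.

Lemma card_posets_ge n : 2 ^ (n./2 * (n - n./2)) <= #|posets n|.
Proof.
pose A : {set 'I_n} := [set i : 'I_n | i < n./2].
have cA : #|A| = n./2.
  rewrite -sum1dep_card -(big_ord_widen n (fun=> 1)); last by lia.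
  by rewrite sum1_card card_ord.
have <- : #|finset.setX A (~: A)| = n./2 * (n - n./2).
  by rewrite cardsX [#|~: A|]cardsCs finset.setCK cA card_ord.
rewrite -card_powerset; apply/subset_leq_card/fintype.subsetP => P.
by rewrite powersetE; exact: posets_bipartite.
Qed.

(** * Error terms and the final estimate *)

Lemma sqr_le_exp2 k : k ^ 2 <= 2 * 2 ^ k.
Proof.
(* The induction step uses (k+1)^2 <= 2k^2, which holds from k = 3 on. *)
elim: k => [//|k IHk]; case: (ltnP k 3) => [|k3].
  by case: k IHk => [|[|[|]]].
by rewrite (expnS 2); nia.
Qed.

Lemma up_log2_sqr n : 0 < n -> up_log 2 n ^ 2 <= 4 * n.
Proof.
move=> n0; case: (ltnP 1 n) => [n1|]; last by case: n n0 => [|[|]].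
have /andP[lt _] := up_log_bounds (isT : 1 < 2) n1.
have l0 : 0 < up_log 2 n by rewrite up_log_gt0 n1.
apply: leq_trans (sqr_le_exp2 _) _; rewrite -(prednK l0) expnS; lia.
Qed.

(** Everything is multiplied by 4 and by the number of posets, so that the estimate stays in
    [nat]. *)
Lemma sum_comparisons_bound (phi : learning_algorithm) n (l := up_log 2 n.+1) :
    0 < n ->
  #|posets n| * (n ^ 2) <=
    4 * \sum_(P in posets n) comparisons phi P
    + #|posets n| * (4 * (n.+1 * l) + 4 * n + 1).
Proof.
(* In the subtracted [n.+1 * l], the part [n * l] pays for the heights and one more [l] makes early
   posets at most a fraction 1/n. If the subtraction truncates to 0, the bound is trivial. *)
move=> n_gt0; set m := n./2 * (n - n./2); set k := m - n.+1 * l.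
set N := #|posets n|; set S := \sum_(P in _) _.
have m_ge : n ^ 2 <= 4 * m + 1.
  by rewrite /m -{1 3}(odd_double_half n) -mul2n; case: odd; nia.
have nl : n.+1 <= 2 ^ l by exact: up_logP.
have early_le : 0 < k -> #|early phi n k| * n <= N.
  move=> k_gt0; apply: leq_trans (card_posets_ge n); rewrite -/m.
  apply: (@leq_trans (2 ^ (l * n) * 2 ^ k * 2 ^ l)).
    rewrite leq_mul //; last exact: ltnW.
    apply: leq_trans (card_early phi n_gt0 k) _.
    by rewrite leq_mul2r expnM leq_exp2r // nl orbT.
  by rewrite -!expnD leq_exp2l // /k; move: k_gt0; rewrite /k; nia.
have Sk := sum_comparisons_ge phi n k; rewrite -/N -/S in Sk.
have NkS : N * k <= S + N * n.
  have [->|k_gt0] := posnP k; first by rewrite muln0.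
  apply: leq_trans Sk _; rewrite leq_add2l.
  (* As k <= n^2, the early posets cost at most n comparisons on average. *)
  apply: (@leq_trans (#|early phi n k| * n * n)).
    rewrite -mulnA leq_mul2l; apply/orP; right; rewrite /k /m; nia.
  by rewrite leq_mul2r early_le ?orbT.
have : m <= k + n.+1 * l by rewrite /k; lia.
move: m_ge NkS; clearbody N S m k l; nia.
Qed.

Local Open Scope classical_set_scope.
Local Open Scope ring_scope.

Lemma up_log2_le_sqrt (R : realType) n : (0 < n)%N ->
  (up_log 2 n)%:R <= 2 * Num.sqrt (n%:R : R).
Proof.
move=> n_gt0; rewrite -(@ler_pXn2r _ 2) ?nnegrE ?mulr_ge0 ?sqrtr_ge0 //.
by rewrite exprMn sqr_sqrtr // -!natrX -natrM ler_nat up_log2_sqr.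
Qed.

Lemma cvg_sqrt_div (R : realType) :
  (Num.sqrt (n%:R : R) / n%:R) @[n --> \oo] --> (0 : R).
Proof.
(* The shift avoids n = 0, where sqrt(n)/n = sqrt(1/n) would need division by zero. *)
rewrite -cvg_shiftS /=.
have -> : (fun n => Num.sqrt n.+1%:R / n.+1%:R) =
          (fun n => Num.sqrt (harmonic n : R)).
  apply/funext => n; rewrite sqrtrV // -{2}(@sqr_sqrtr _ n.+1%:R) //.
  by rewrite expr2 invfM mulrA divff ?mul1r // sqrtr_eq0 -ltNge.
suff : Num.sqrt (harmonic n : R) @[n --> \oo] --> Num.sqrt (0 : R).
  by rewrite sqrtr0.
by apply: continuous_cvg; [exact: sqrt_continuous|exact: cvg_harmonic].
Qed.

Theorem mainTheorem1 (R : realType) :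
  exists g : nat -> R,
    (g n / n%:R ^+ 2 @[n --> \oo] --> (0 : R)) /\
    (forall (phi : learning_algorithm) (n : nat), (0 < n)%N ->
       n%:R ^+ 2 / 4 - g n <= expected_comparisons R phi n).
Proof.
(* With l <= 4 sqrt(n), the error (n+1)l + n + 1/4 is at most (8 + 1 + 1/4) n sqrt(n). *)
exists (fun n => 10 * (n%:R * Num.sqrt n%:R)); split.
  have -> : (fun n => 10 * (n%:R * Num.sqrt n%:R) / n%:R ^+ 2) =
            (fun n => 10 * (Num.sqrt (n%:R : R) / n%:R)).
    apply/funext => -[|n]; first by rewrite expr2 !mul0r invr0 !mulr0.
    by field.
  suff : 10 * (Num.sqrt n%:R / n%:R) @[n --> \oo] --> 10 * (0 : R).
    by rewrite mulr0.
  by apply: cvgMl_tmp; exact: cvg_sqrt_div.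
move=> phi n n_gt0; rewrite /expected_comparisons.
have N_gt0 : 0 < #|posets n|%:R :> R.
  by rewrite ltr0n (leq_trans _ (card_posets_ge n)) // expn_gt0.
rewrite ler_pdivlMl // -natr_sum.
have := sum_comparisons_bound phi n_gt0.
rewrite -(ler_nat R) !(natrD, natrM, natrX).
set l := (up_log _ _)%:R; set s := Num.sqrt _; set N := #|_|%:R.
set S := (\sum_(P in _) _)%:R.
have n_ge1 : 1 <= n%:R :> R by rewrite ler1n.
have s_ge1 : 1 <= s by rewrite -sqrtr1 ler_wsqrtr.
(* For n >= 1, n + 1 <= 4n, which turns the root of n + 1 into twice that of n. *)
have l_le : l <= 4 * s.
  apply: le_trans (@up_log2_le_sqrt R n.+1 isT) _.
  have -> : 4 * s = 2 * Num.sqrt (2 ^+ 2 * n%:R).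
    by rewrite sqrtrM ?sqr_ge0 // sqrtr_sqr ger0_norm // -/s; ring.
  by rewrite ler_pM2l // ler_wsqrtr // -natrX -natrM ler_nat; lia.
have l_ge0 : 0 <= l by rewrite ler0n.
have err : (n%:R + 1) * l + n%:R + 4^-1 <= 10 * (n%:R * s) by nra.
rewrite -[n.+1%:R]natr1 => bound.
have : N * ((n%:R + 1) * l + n%:R + 4^-1) <= N * (10 * (n%:R * s)).
  by rewrite ler_pM2l.
by nra.
Qed.
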